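(* Let $K$ be a field, $S=K[x_1,\ldots,x_n]$, $\mathfrak m=(x_1,\ldots,x_n)$, and let $I=P_{F_1}\cdots P_{F_r}\subset S$ be a transversal polymatroidal ideal. Then $\mathfrak m\in\operatorname{Ass}(I)$ if and only if $\bigcup_{i=1}^r F_i=[n]$ and the graph $G_I$ is connected.
   Context: $[n]=\{1,\ldots,n\}$. For a non-empty subset $F\subset[n]$, $P_F=(x_i : i\in F)$. A transversal polymatroidal ideal is an ideal of the form $I=P_{F_1}\cdots P_{F_r}$, where $r\ge1$ and $F_1,\ldots,F_r$ is a collection of non-empty, not necessarily distinct, subsets of $[n]$. $G_I$ is the graph with vertex set $\{1,\ldots,r\}$ in which, for $i\ne j$, $\{i,j\}$ is an edge if and only if $F_i\cap F_j\neq\emptyset$. $\operatorname{Ass}(I)$ denotes the set of associated prime ideals of $S/I$. *)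

(* Defs.v *)
From HB Require Import structures.
From mathcomp Require Import all_boot all_order all_algebra.
From mathcomp Require Import mpoly.

Set Implicit Arguments.
Unset Strict Implicit.
Unset Printing Implicit Defensive.

Import GRing.Theory.
Local Open Scope ring_scope.

(* Membership in an ideal of a polynomial ring over an arbitrary field is not
   assumed decidable, so ideals are Prop-valued predicates, and equality of
   ideals is read extensionally. *)
Section Ideals.
Variable R : comNzRingType.
Implicit Types (A I J P : R -> Prop).

Definition is_ideal I : Prop :=
  [/\ I 0, forall x y, I x -> I y -> I (x + y)
    & forall a x, I x -> I (a * x)].

Definition ideal_gen A : R -> Prop := fun x =>
  exists (m : nat) (a g : 'I_m -> R),
    (forall k, A (g k)) /\ x = \sum_(k < m) a k * g k.

Definition unit_ideal : R -> Prop := fun=> True.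

Definition ideal_mul I J : R -> Prop :=
  ideal_gen (fun z => exists x y, [/\ I x, J y & z = x * y]).

Definition is_prime_ideal P : Prop :=
  [/\ is_ideal P, ~ P 1 & forall x y, P (x * y) -> P x \/ P y].

(* The annihilator of the residue class of f in R / I: g kills f + I exactly
   when g * f lies in I. *)
Definition ann_class I (f : R) : R -> Prop := fun g => I (g * f).

Definition Ass I P : Prop :=
  is_prime_ideal P /\ exists f : R, forall g, P g <-> ann_class I f g.

End Ideals.

Section Transversal.
Variables (K : fieldType) (n : nat).

(* The variables are indexed by 'I_n = {0, ..., n-1} instead of {1, ..., n}. *)
Definition var_ideal (F : {set 'I_n}) : {mpoly K[n]} -> Prop :=
  ideal_gen (fun p => exists2 i, i \in F & p = 'X_i).

Definition irrelevant_ideal : {mpoly K[n]} -> Prop := var_ideal [set: 'I_n].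

Definition transversal_ideal (r : nat) (F : 'I_r -> {set 'I_n}) :
    {mpoly K[n]} -> Prop :=
  \big[@ideal_mul {mpoly K[n]} / @unit_ideal {mpoly K[n]}]_(k < r)
    var_ideal (F k).

End Transversal.

Arguments irrelevant_ideal K n : clear implicits.
Arguments transversal_ideal K {n r} F.

Definition intersection_graph (n r : nat) (F : 'I_r -> {set 'I_n}) :
    rel 'I_r :=
  fun i j => (i != j) && (F i :&: F j != set0).

(* For a symmetric e, connect e is the existence of a path; the vertex set is
   nonempty wherever this is used. *)
Definition graph_connected (T : finType) (e : rel T) : Prop :=
  forall x y : T, connect e x y.

(* Main.v *)
Require Import Defs.
From mathcomp Require Import all_boot all_order all_algebra.
From mathcomp Require Import mpoly.

(** A polynomial lies in [I] exactly when each of its monomials is divisible by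
    a product [x_(c 1) ... x_(c r)] with [c k] in [F_k], so everything reduces
    to such choices [c].

    If the graph is connected, grow a set of vertices [A] along edges. Each time
    a vertex [j] is attached through a variable [x_w] with [w] in [F_a :&: F_j],
    [a] in [A], multiply a monomial [f] by [x_w]. For [v] in the union of the
    [F_k], [k] in [A], the monomial [x_v f] stays a product of one variable from
    each [F_k], [k] in [A]. At the end [x_v f] lies in [I] for every [v], whereas
    [f] has degree [r - 1], so [I : f] is the irrelevant ideal.

    Conversely, let [x_v u] lie in [I] for all [v], with [u] a monomial. If some
    [v] is in no [F_k], then [u] is in [I]. If [k] and [l] are not connected,
    use the choice made for [x_w u], [w] in [F_l], on the component of [k], and
    the choice made for [x_v u], [v] in [F_k], off it: the variables involved are
    disjoint, and [u] is again in [I]. *)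

Set Implicit Arguments.
Unset Strict Implicit.
Unset Printing Implicit Defensive.

(** * Ideals generated by a set *)

Section IdealTheory.
Import GRing.Theory.
Local Open Scope ring_scope.
Variable R : comNzRingType.
Implicit Types (A I : R -> Prop).

Lemma ideal_sum I (T : eqType) (s : seq T) (f : T -> R) :
  is_ideal I -> (forall t, t \in s -> I (f t)) -> I (\sum_(t <- s) f t).
Proof.
case=> I0 ID _ If; rewrite big_seq.
by elim/big_rec: _ => // t x /If; apply: ID.
Qed.

Lemma ideal_gen_sub A I :
  is_ideal I -> (forall x, A x -> I x) -> forall x, ideal_gen A x -> I x.
Proof.
move=> idI sAI _ [m [a [g [Ag ->]]]]; apply: ideal_sum => // k _.
by case: idI => _ _; apply; apply/sAI/Ag.
Qed.

Lemma ideal_gen_mem A x : A x -> ideal_gen A x.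
Proof.
move=> Ax; exists 1%N, (fun=> 1), (fun=> x).
by rewrite big_ord1 mul1r.
Qed.

Lemma ideal_gen_ideal A : is_ideal (ideal_gen A).
Proof.
split.
- by exists 0%N, (fun=> 0), (fun=> 0); rewrite big_ord0; split=> // -[].
- move=> _ _ [m [a [g [Ag ->]]]] [p [b [h [Ah ->]]]].
  exists (m + p)%N.
  exists (fun k => match split k with inl i => a i | inr j => b j end).
  exists (fun k => match split k with inl i => g i | inr j => h j end).
  split=> [k|]; first by case: (split k).
  rewrite big_split_ord /=; congr (_ + _); apply: eq_bigr => k _.
    by rewrite -[lshift p k]/(unsplit (inl k)) unsplitK.
  by rewrite -[rshift m k]/(unsplit (inr k)) unsplitK.
- move=> c _ [m [a [g [Ag ->]]]]; exists m, (fun k => c * a k), g; split=> //.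
  by rewrite mulr_sumr; apply: eq_bigr => k _; rewrite mulrA.
Qed.

End IdealTheory.

(** * Membership in monomial ideals, read on the support *)

Section Monomials.
Import GRing.Theory.
Local Open Scope ring_scope.
Variables (K : fieldType) (n : nat).
Implicit Types (p q : {mpoly K[n]}) (m u : 'X_{1..n}).

(** Supports of sums and products contain no monomials beyond the expected ones. Combined with
    [ideal_gen_sub], this shows that a condition on the generators' monomials passes to the whole
    ideal. *)
Lemma msupp_ideal (Q : pred 'X_{1..n}) :
    (forall m u, Q m -> Q (u + m)%MM) ->
  is_ideal (fun p => {in msupp p, forall m, Q m}).
Proof.
move=> upQ; split.
- by move=> m; rewrite msupp0.
- move=> p q Qp Qq m /msuppD_le; rewrite mem_cat.
  by case/orP; [apply: Qp | apply: Qq].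
- move=> a p Qp m /msuppM_le /allpairsP [[m1 m2] /= [_ /Qp Qm2 ->]].
  exact: upQ.
Qed.

Lemma monomials_in_ideal (I : {mpoly K[n]} -> Prop) p :
  is_ideal I -> {in msupp p, forall m, I 'X_[m]} -> I p.
Proof.
move=> idI Ip; rewrite (mpolyE p); apply: ideal_sum => // m /Ip Im.
by case: idI => _ _ IM; rewrite -mul_mpolyC; apply: IM.
Qed.

Lemma var_idealP (F : {set 'I_n}) p :
  var_ideal F p <->
  {in msupp p, forall m, [exists i in F, (U_(i) <= m)%MM]}.
Proof.
split.
  move: p; apply: ideal_gen_sub => [|_ [i Fi ->] m].
    apply: (@msupp_ideal (fun m => [exists i in F, (U_(i) <= m)%MM])) => m u.
    move=> /exists_inP [i Fi le_im]; apply/exists_inP; exists i => //.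
    exact: lepm_trans le_im (lem_addl _ _).
  rewrite msuppX inE => /eqP ->; apply/exists_inP; exists i => //.
  exact: lepm_refl.
move=> Fp; apply: monomials_in_ideal => [|m /Fp /exists_inP [i Fi le_im]].
  exact: ideal_gen_ideal.
have Xi : var_ideal F ('X_i : {mpoly K[n]}) by apply: ideal_gen_mem; exists i.
case: (ideal_gen_ideal (fun q : {mpoly K[n]} => exists2 j, j \in F & q = 'X_j)).
by move=> _ _ IM; rewrite -(submK le_im) mpolyXD; apply: IM.
Qed.

Lemma irrelevant_idealP p : irrelevant_ideal K n p <-> p@_0%MM = 0.
Proof.
rewrite /irrelevant_ideal var_idealP; split=> [p0|/eqP p0 m mp].
  apply/eqP; rewrite mcoeff_eq0; apply/negP => /p0 /exists_inP [i _].
  by move/mnm_lepP/(_ i); rewrite mnm1E mnm0E eqxx.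
have: m != 0%MM by apply: contraTneq mp => ->; rewrite -mcoeff_eq0.
rewrite -mdeg_eq0 mdegE sum_nat_eq0 => /forallPn /= [i mi].
apply/exists_inP; exists i; rewrite ?inE //.
by apply/mnm_lepP=> j; rewrite mnm1E; case: eqP => // <-; rewrite lt0n.
Qed.

(** The ideal is the kernel of the constant coefficient, a ring morphism to a field. *)
Lemma irrelevant_prime : is_prime_ideal (irrelevant_ideal K n).
Proof.
split; first exact: ideal_gen_ideal.
  by rewrite irrelevant_idealP mcoeff1 eqxx => /eqP; rewrite oner_eq0.
move=> p q; rewrite !irrelevant_idealP (mcoeff0_is_multiplicative n K).1.
by move/eqP; rewrite mulf_eq0 => /orP [] /eqP; [left | right].
Qed.

(** Finite functions make the existence of a choice boolean, so that it can be negated and tested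
    over a support. *)
Definition div_by_transversal r (F : 'I_r -> {set 'I_n}) m : bool :=
  [exists c : {ffun 'I_r -> 'I_n},
     [forall k, c k \in F k] && ((\sum_(k < r) U_(c k))%MM <= m)%MM].

Lemma div_by_transversalP r (F : 'I_r -> {set 'I_n}) m :
  reflect (exists c : 'I_r -> 'I_n, (forall k, c k \in F k) /\
             ((\sum_(k < r) U_(c k))%MM <= m)%MM)
          (div_by_transversal F m).
Proof.
apply: (iffP existsP) => [[c /andP [/forallP Fc le_cm]]|[c [Fc le_cm]]].
  by exists c.
exists [ffun k => c k]; apply/andP; split.
  by apply/forallP => k; rewrite ffunE.
by under eq_bigr => k _ do rewrite ffunE.
Qed.

Lemma div_by_transversal_up r (F : 'I_r -> {set 'I_n}) m u :
  div_by_transversal F m -> div_by_transversal F (u + m)%MM.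
Proof.
move=> /div_by_transversalP [c [Fc le_cm]]; apply/div_by_transversalP.
by exists c; split=> //; apply: lepm_trans le_cm (lem_addl _ _).
Qed.

Lemma transversal_ideal_recl r (F : 'I_r.+1 -> {set 'I_n}) :
  transversal_ideal K F =
  ideal_mul (var_ideal (F ord0))
    (transversal_ideal K (fun k => F (lift ord0 k))).
Proof. by rewrite /transversal_ideal big_ord_recl. Qed.

Lemma transversal_ideal_ideal r (F : 'I_r -> {set 'I_n}) :
  is_ideal (transversal_ideal K F).
Proof.
case: r F => [|r] F; first by rewrite /transversal_ideal big_ord0.
rewrite transversal_ideal_recl; exact: ideal_gen_ideal.
Qed.

Lemma div_by_transversal_cons r (F : 'I_r.+1 -> {set 'I_n}) i m u :
    i \in F ord0 -> (U_(i) <= u)%MM ->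
    div_by_transversal (fun k => F (lift ord0 k)) m ->
  div_by_transversal F (u + m)%MM.
Proof.
move=> Fi le_iu /div_by_transversalP [c [Fc le_cm]].
apply/div_by_transversalP.
(* [unlift ord0 k] is [None] only at [ord0], where the choice takes the value [i]. *)
exists (fun k => oapp c i (unlift ord0 k)); split.
  by move=> k; case: unliftP => [j ->|->] /=.
rewrite big_ord_recl unlift_none /=; under eq_bigr => k _ do rewrite liftK /=.
by apply/mnm_lepP => j; rewrite !mnmDE leq_add //; apply/mnm_lepP.
Qed.

Lemma transversal_monomial r (F : 'I_r -> {set 'I_n}) (c : 'I_r -> 'I_n) :
  (forall k, c k \in F k) ->
  transversal_ideal K F 'X_[(\sum_(k < r) U_(c k))%MM].
Proof.
elim: r F c => [|r IHr] F c Fc; first by rewrite /transversal_ideal big_ord0.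
rewrite transversal_ideal_recl big_ord_recl mpolyXD.
apply: ideal_gen_mem; exists 'X_(c ord0).
exists 'X_[(\sum_(k < r) U_(c (lift ord0 k)))%MM]; split=> //.
  by apply: ideal_gen_mem; exists (c ord0).
by apply: IHr => k; apply: Fc.
Qed.

Lemma transversal_idealP r (F : 'I_r -> {set 'I_n}) p :
  transversal_ideal K F p <->
  {in msupp p, forall m, div_by_transversal F m}.
Proof.
split; last first.
  move=> Fp; apply: monomials_in_ideal => [|m /Fp].
    exact: transversal_ideal_ideal.
  case/div_by_transversalP => c [Fc le_cm].
  have [_ _ IM] := transversal_ideal_ideal F.
  by rewrite -(submK le_cm) mpolyXD; apply/IM/transversal_monomial.
elim: r F p => [|r IHr] F p.
  (* The empty product is the unit ideal, and the empty choice gives the monomial 1. *)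
  move=> _ m _; apply/div_by_transversalP.
  exists (fun k : 'I_0 => match notF (ltn_ord k) with end).
  split; first by case.
  by rewrite big_ord0; apply/mnm_lepP => i; rewrite mnm0E.
rewrite transversal_ideal_recl; move: p; apply: ideal_gen_sub.
  apply: (@msupp_ideal (div_by_transversal F)) => m u.
  exact: div_by_transversal_up.
move=> _ [x [y [/var_idealP Fx /IHr Fy ->]]] m.
move=> /msuppM_le /allpairsP [[m1 m2] /= [/Fx + /Fy Fm2 ->]].
case/exists_inP => i Fi le_i; exact: div_by_transversal_cons Fi le_i Fm2.
Qed.

Lemma transversal_idealX r (F : 'I_r -> {set 'I_n}) m :
  transversal_ideal K F 'X_[m] <-> div_by_transversal F m.
Proof.
rewrite transversal_idealP; split=> [|Fm m']; last by rewrite msuppX inE => /eqP ->.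
by apply; rewrite msuppX inE.
Qed.

Lemma mdeg_div_by_transversal r (F : 'I_r -> {set 'I_n}) m :
  div_by_transversal F m -> (r <= mdeg m)%N.
Proof.
case/div_by_transversalP => c [_ /submK <-].
rewrite mdegD mdeg_sum (eq_bigr (fun=> 1%N)) => [|k _]; last by rewrite mdeg1.
by rewrite sum1_card card_ord leq_addl.
Qed.

End Monomials.

(** * Choices of variables and connectedness of the graph *)

Section Choices.
Variables (n r : nat) (F : 'I_r -> {set 'I_n}).
Implicit Types (A : {set 'I_r}) (m u f : 'X_{1..n}).

Lemma intersection_graph_connect_sym : connect_sym (intersection_graph F).
Proof.
by apply: sym_connect_sym => i j; rewrite /intersection_graph eq_sym setIC.
Qed.

(** Equality instead of divisibility fixes the degree of [m] as the size of [A]. *)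
Definition is_transversal_of A m : Prop :=
  exists c : 'I_r -> 'I_n,
    (forall k, k \in A -> c k \in F k) /\ m = (\sum_(k in A) U_(c k))%MM.

Lemma is_transversal_ofU1 A j v m :
    j \notin A -> v \in F j -> is_transversal_of A m ->
  is_transversal_of (j |: A) (U_(v) + m)%MM.
Proof.
move=> jA Fv [c [Fc ->]]; exists (fun k => if k == j then v else c k).
split=> [k|].
  by rewrite in_setU1; case: eqP => [-> //|_ /=]; apply: Fc.
rewrite big_setU1 //= eqxx; congr (_ + _)%MM; apply: eq_bigr => k kA.
by case: eqP kA jA => // -> ->.
Qed.

Lemma connected_exit A a b :
    graph_connected (intersection_graph F) -> a \in A -> b \notin A ->
  exists i j, [/\ i \in A, j \notin A & F i :&: F j != set0].
Proof.
move=> conn aA bA.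
case: (pickP (fun ij : 'I_r * 'I_r =>
         [&& ij.1 \in A, ij.2 \notin A & F ij.1 :&: F ij.2 != set0])).
  by case=> i j /and3P [] ? ? ?; exists i, j.
(* With no edge leaving it, [A] is a union of components, so the path from [a] to [b] stays
   inside. *)
move=> noexit; have clA : closed (intersection_graph F) A.
  apply: intro_closed => [|i j /andP [_ Fij] iA].
    exact: intersection_graph_connect_sym.
  by have:= noexit (i, j); rewrite /= iA Fij andbT /=; case: (j \in A).
by move: bA; rewrite -(closed_connect clA (conn a b)) aA.
Qed.

Lemma transversal_cofactor (k0 : 'I_r) :
    graph_connected (intersection_graph F) ->
  exists f, forall k v, v \in F k -> is_transversal_of setT (U_(v) + f)%MM.
Proof.
move=> conn.
(* Induction on the number of vertices still outside [A]. *)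
have grow d A f : #|~: A| = d -> k0 \in A ->
    (forall k v, k \in A -> v \in F k -> is_transversal_of A (U_(v) + f)%MM) ->
    exists f, forall k v, v \in F k -> is_transversal_of setT (U_(v) + f)%MM.
  elim: d A f => [|d IHd] A f.
    move/cards0_eq/(congr1 (@setC _)); rewrite setCK setC0 => -> _ Af.
    by exists f => k v; apply: Af; rewrite inE.
  move=> cardA k0A Af.
  have /set0Pn [b] : ~: A != set0 by rewrite -card_gt0 cardA.
  rewrite inE => bA.
  have [a [j [aA jA /set0Pn [w]]]] := connected_exit conn k0A bA.
  rewrite inE => /andP [Faw Fjw].
  apply: (IHd (j |: A) (U_(w) + f)%MM).
  - apply: succn_inj; rewrite -cardA [RHS](cardsD1 j) inE jA add1n.
    by rewrite setDE setIC -setCU.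
  - by rewrite inE k0A orbT.
  (* If [k] is the new vertex [j], it takes [v] while [w], lying in [F a], serves [A]; otherwise [v]
     serves [A] and [j] takes [w]. *)
  move=> k v; rewrite in_setU1 => /orP [/eqP ->|kA] Fv.
    exact: is_transversal_ofU1 jA Fv (Af _ _ aA Faw).
  by rewrite addmA [(_ + U_(w))%MM]addmC -addmA; apply/is_transversal_ofU1/(Af k).
apply: (grow _ [set k0] 0%MM erefl); first by rewrite inE.
move=> k v; rewrite inE => /eqP -> Fv; exists (fun=> v); split.
  by move=> k'; rewrite inE => /eqP ->.
by rewrite big_set1 addm0.
Qed.

Lemma div_by_transversal_setT m :
  is_transversal_of setT m -> div_by_transversal F m.
Proof.
case=> c [Fc ->]; apply/div_by_transversalP; exists c; split=> [k|].
  by apply: Fc; rewrite inE.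
by under [X in (_ <= X)%MM]eq_bigl => k do rewrite inE; apply: lepm_refl.
Qed.

Lemma socle_graph_connected u :
    (forall k, F k != set0) ->
    (forall v, div_by_transversal F (U_(v) + u)%MM) ->
    ~~ div_by_transversal F u ->
  graph_connected (intersection_graph F).
Proof.
move=> Fn0 Fu Nu k l; apply: contraNT Nu => Nkl.
have [v Fkv] := set0Pn _ (Fn0 k); have [w Flw] := set0Pn _ (Fn0 l).
have /div_by_transversalP [c [Fc /mnm_lepP le_c]] := Fu v.
have /div_by_transversalP [c' [Fc' /mnm_lepP le_c']] := Fu w.
pose A := connect (intersection_graph F) k.
(* A common variable would be an edge leaving the component [A] of [k]. *)
have disjA i j x : i \in A -> j \notin A -> x \in F i -> x \notin F j.
  move=> iA jA Fix; apply: contra jA => Fjx.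
  have [<- //|ij] := eqVneq i j.
  apply: connect_trans iA (connect1 _); rewrite /intersection_graph ij /=.
  by apply/set0Pn; exists x; rewrite inE Fix.
apply/div_by_transversalP; exists (fun j => if j \in A then c' j else c j).
split=> [j|]; first by case: ifP.
apply/mnm_lepP => i; rewrite mnm_sumE.
have [/exists_inP [j jA Fji]|Ni] := boolP [exists j in A, i \in F j].
  (* Only vertices of [A] can choose [i], so [c'] bounds the exponent; and [i] is not [w], since [l]
     is off [A]. *)
  apply: leq_trans (_ : (\sum_(k < r) U_(c' k))%MM i <= _).
    rewrite mnm_sumE; apply: leq_sum => k' _; case: ifP => // /negbT k'A.
    rewrite mnm1E; case: eqP => // cki.
    by have:= disjA _ _ _ jA k'A Fji; rewrite -cki Fc.
  have := le_c' i; rewrite mnmDE [X in _ <= X + _]mnm1E; case: eqP => // wi.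
  by have:= disjA _ _ _ jA Nkl Fji; rewrite -wi Flw.
(* Here no vertex of [A] can choose [i], so [c] bounds the exponent; and [i] is not [v], since [k]
   is in [A]. *)
apply: leq_trans (_ : (\sum_(k < r) U_(c k))%MM i <= _).
  rewrite mnm_sumE; apply: leq_sum => k' _; case: ifP => // k'A.
  rewrite mnm1E; case: eqP => // cki.
  by case/exists_inP: Ni; exists k' => //; rewrite -cki Fc'.
have := le_c i; rewrite mnmDE [X in _ <= X + _]mnm1E; case: eqP => // vi.
by case/exists_inP: Ni; exists k; rewrite -?vi //; apply: connect0.
Qed.

Lemma socle_cover u :
    (forall v, div_by_transversal F (U_(v) + u)%MM) ->
    ~~ div_by_transversal F u ->
  \bigcup_(k < r) F k = [set: 'I_n].
Proof.
move=> Fu Nu; apply/setP => v; rewrite inE; apply: contraNT Nu => Nv.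
have /div_by_transversalP [c [Fc /mnm_lepP le_c]] := Fu v.
apply/div_by_transversalP; exists c; split=> //; apply/mnm_lepP => i.
have := le_c i; rewrite mnmDE [X in _ <= X + _]mnm1E; case: eqP => // <- _.
(* At [v] itself the exponent is 0, as no [F k] contains [v]. *)
rewrite mnm_sumE big1 // => k _; rewrite mnm1E; case: eqP => // ckv.
by case/bigcupP: Nv; exists k; rewrite // -ckv.
Qed.

End Choices.

(** * The irrelevant ideal as an associated prime *)

Theorem theorem3p3 (K : fieldType) (n r : nat) (F : 'I_r -> {set 'I_n})
    (r_gt0 : (0 < r)%N) (F_neq0 : forall k : 'I_r, F k != set0) :
  Ass (transversal_ideal K F) (irrelevant_ideal K n) <->
  \bigcup_(k < r) F k = [set: 'I_n] /\
  graph_connected (intersection_graph F).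
Proof.
split.
  case=> -[_ m1 _] [f mf].
  (* [f] is not in the ideal, since 1 does not annihilate its class; so some monomial [u] of [f] is
     outside. *)
  have Nf : ~~ all (div_by_transversal F) (msupp f).
    apply/negP => /allP /transversal_idealP If; apply: m1; apply/mf.
    by rewrite /ann_class GRing.mul1r.
  have [u uf Nu] := allPn Nf.
  have Fu v : div_by_transversal F (U_(v) + u)%MM.
    have /mf/transversal_idealP : irrelevant_ideal K n 'X_v.
      by apply: ideal_gen_mem; exists v; rewrite ?inE.
    (* Multiplying by a variable shifts the support without cancellation. *)
    by apply; rewrite GRing.mulrC (perm_mem (msuppMX _ _)); apply: map_f.
  by split; [apply: socle_cover Fu Nu | apply: socle_graph_connected Fu Nu].
case=> cover conn; split; first exact: irrelevant_prime.
pose k0 := Ordinal r_gt0.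
have [f Ff] := transversal_cofactor k0 conn.
have [v0 Fv0] := set0Pn _ (F_neq0 k0).
have deg_f : (mdeg f).+1 = r.
  have [c [_ /(congr1 (@mdeg n))]] := Ff _ _ Fv0.
  rewrite mdegD mdeg1 mdeg_sum (eq_bigr (fun=> 1)) => [|k _]; last by rewrite mdeg1.
  by rewrite sum1_card cardsT card_ord add1n.
have idI := transversal_ideal_ideal K F.
exists 'X_[f] => g; rewrite /ann_class; split.
  apply: (@ideal_gen_sub _ _ (ann_class (transversal_ideal K F) 'X_[f])).
    case: idI => I0 ID IM; rewrite /ann_class; split=> [|x y Ix Iy|a x Ix].
    - by rewrite GRing.mul0r.
    - by rewrite GRing.mulrDl; apply: ID.
    - by rewrite -GRing.mulrA; apply: IM.
  move=> _ [v _ ->]; rewrite /ann_class -mpolyXD; apply/transversal_idealX.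
  have: v \in \bigcup_(k < r) F k by rewrite cover inE.
  by case/bigcupP => k _ Fv; apply/div_by_transversal_setT/Ff/Fv.
move/transversal_idealP => Igf; apply/irrelevant_idealP/eqP.
rewrite mcoeff_eq0; apply/negP => g0.
(* A constant term of [g] would put [f], of degree [r - 1], in the support of an element of an ideal
   whose monomials have degree at least [r]. *)
have /Igf/mdeg_div_by_transversal : f \in msupp (g * 'X_[f])%R.
  by rewrite (perm_mem (msuppMX _ _)); apply/mapP; exists 0%MM; rewrite ?addm0.
by rewrite -deg_f ltnn.
Qed.
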